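(* Let $b\ge 3$ be an odd integer and $n$ an even positive integer. Let $K(i,j)$, for $i,j\in\{-\tfrac n2,\dots,\tfrac n2\}$, be the transition probability of the balanced carries Markov chain (defined in the context). Then $K(i,j)$ is equal to both: (1) the coefficient of $x^{jb+(n+1)(b-1)/2-i}$ in $(1+x+\cdots+x^{b-1})^{n+1}/b^n$; (2) $\displaystyle \frac{1}{b^n}\sum_{l=0}^{\lfloor j+\frac{n+1}{b}\frac{b-1}{2}-\frac{i}{b}\rfloor}(-1)^l\binom{n+1}{l}\binom{n+jb+(n+1)\frac{b-1}{2}-i-lb}{n}$.
   Context: Balanced digits base $b$ ($b$ odd) are the integers $-\tfrac{b-1}{2},\dots,0,\dots,\tfrac{b-1}{2}$. When $n$ numbers written in balanced digits are added column by column from right to left, if the carry into a column is $i$ and the digits in that column are $X_1,\dots,X_n$, the carry out of the column is the unique integer $j$ with $jb-\tfrac{b-1}{2}\le i+X_1+\cdots+X_n\le jb+\tfrac{b-1}{2}$. The first carry is $0$. When all digits are chosen independently and uniformly from the balanced digit set, the successive carries form a Markov chain, the balanced carries chain; for $n$ even its state space is $\{-\tfrac n2,\dots,\tfrac n2\}$, and $K(i,j)$ denotes the probability that the carry out is $j$ given the carry in is $i$. *)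

(* Defs.v *)
From HB Require Import structures.
From mathcomp Require Import all_boot all_order all_algebra.
From mathcomp Require Import zify.

Set Implicit Arguments.
Unset Strict Implicit.
Unset Printing Implicit Defensive.

Import Order.TTheory GRing.Theory Num.Theory.

Local Open Scope ring_scope.

Definition half_base (b : nat) : int := (b.-1)./2%:Z.

(* The balanced digits base b are enumerated in increasing order by 'I_b. *)
Definition digit (b : nat) (d : 'I_b) : int := d%:Z - half_base b.

Lemma digit_inj (b : nat) : injective (@digit b).
Proof. by move=> x y; rewrite /digit => e; apply/val_inj => /=; lia. Qed.

Lemma digit_range (b : nat) (x : int) : odd b ->
  (exists d : 'I_b, digit d = x) <-> (- half_base b <= x <= half_base b).
Proof.
move=> ob; rewrite /digit /half_base; split=> [[[d db] /= <-]|xb]; first by lia.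
have lt_b : (`|(x + (b.-1)./2%:Z)%R| < b)%N by lia.
by exists (Ordinal lt_b) => /=; lia.
Qed.

(* The n digits standing in one column. *)
Notation column b n := {ffun 'I_n -> 'I_b}.

Definition column_sum (b n : nat) (X : column b n) : int := \sum_k digit (X k).

Definition is_carry (b : nat) (s j : int) : bool :=
  j * b%:Z - half_base b <= s <= j * b%:Z + half_base b.

(* Probability of an event under the uniform distribution on a finite type. *)
Definition unif_prob (T : finType) (A : pred T) : rat := #|A|%:R / #|T|%:R.

(* The uniform distribution on column b n is the law of n independent uniform
   digits. *)
Definition carries_K (b n : nat) (i j : int) : rat :=
  unif_prob (fun X : column b n => is_carry b (i + column_sum X) j).

(* Consistency checks: the carry exists and is unique, and carries_K is the
   transition kernel of the process of successive carries. *)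

Definition carry (b : nat) (s : int) : int := ((s + half_base b) %/ b%:Z)%Z.

Lemma is_carryE (b : nat) (s j : int) :
  odd b -> is_carry b s j = (j == carry b s).
Proof.
move=> ob; rewrite /is_carry /carry /half_base.
have b0 : (0 : int) < b%:Z by lia.
have eb : b%:Z = (b.-1)./2%:Z + (b.-1)./2%:Z + 1 by lia.
set h := (b.-1)./2%:Z in eb *; set B := b%:Z in b0 eb *.
have e := divz_eq (s + h) B.
have r0 : 0 <= ((s + h) %% B)%Z by rewrite modz_ge0 // gt_eqF.
have r1 := ltz_pmod (s + h) b0.
set q := ((s + h) %/ B)%Z in e *; set r := ((s + h) %% B)%Z in e r0 r1 *.
apply/idP/eqP => [/andP[h1 h2]|->]; last by lia.
by nia.
Qed.

(* Columns are listed from right to left; the first carry is 0. *)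
Definition carry_after (b n : nat) (x : seq (column b n)) : int :=
  foldl (fun c X => carry b (c + column_sum X)) 0 x.

(* Markov property: A is an arbitrary event depending on the first t columns. *)
Lemma carries_K_markov (b n t : nat) (i j : int)
    (A : pred (seq (column b n))) :
  odd b ->
  unif_prob (fun x : t.+1.-tuple (column b n) =>
     [&& A (take t x), carry_after (take t x) == i & carry_after x == j])
  = unif_prob (fun x : t.-tuple (column b n) => A x && (carry_after x == i))
    * carries_K b n i j.
Proof.
move=> ob; rewrite /carries_K /unif_prob mulrACA -invfM -!natrM.
congr (_%:R / _%:R); last by rewrite !card_tuple expnSr.
rewrite -cardX.
pose f (p : t.-tuple (column b n) * column b n) : t.+1.-tuple (column b n) :=
  [tuple of rcons p.1 p.2].
have f_inj : injective f.
  move=> [x X] [y Y] /(congr1 val) /= /rcons_inj [e ->].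
  by congr pair; apply: val_inj.
rewrite -(card_image f_inj); apply: eq_card => x.
have [y [X ->]] : exists y X, x = f (y, X).
  case: x => s; case/lastP: s => [//|s X] sX.
  have ss : size s == t by move: sX; rewrite size_rcons eqSS.
  by exists (Tuple ss), X; apply: val_inj.
rewrite mem_image // !inE /= /in_mem /= -cats1 take_size_cat ?size_tuple //.
rewrite /carry_after foldl_cat /= is_carryE // [j == _]eq_sym -andbA.
by case: (A y) => //=; case: eqP => // <-.
Qed.

(* Coefficient of x^m, which is 0 when the exponent m is negative. *)
Definition coefz (R : nzRingType) (p : {poly R}) (m : int) : R :=
  if m is Posz k then p`_k else 0.

(* Sum over l = 0, ..., u, which is empty when u < 0. *)
Definition sum_upto (R : nmodType) (u : int) (F : nat -> R) : R :=
  if u is Posz N then \sum_(0 <= l < N.+1) F l else 0.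

(* In the closed formula for the transition probabilities the upper argument m
   is always at least k, so the value for m < 0 is never used. *)
Definition binz (m : int) (k : nat) : nat :=
  if m is Posz m' then 'C(m', k) else 0%N.

(* Main.v *)
Require Import Defs.
From HB Require Import structures.
From mathcomp Require Import all_boot all_order all_algebra.
From mathcomp Require Import zify ring.

Set Implicit Arguments.
Unset Strict Implicit.
Unset Printing Implicit Defensive.

Import Order.TTheory GRing.Theory Num.Theory.

Local Open Scope ring_scope.

(* Write P = 1 + X + ... + X^(b-1) and m = jb + (n+1)(b-1)/2 - i. After shifting
   the digits to 0, ..., b-1, the carry out is j exactly when the column sum s
   satisfies s <= m < s + b, that is, when exactly one further digit completes
   the column to the total m; so the favourable columns are counted by the
   coefficient of X^m in P^(n+1). Expanding P^(n+1) = (1 - X^b)^(n+1) /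
   (1 - X)^(n+1) gives the alternating sum, and the bound on l is m/b. *)

(** Distributivity picks one exponent per factor, that is, a column of shifted digits: the power is
    the generating function of column sums. *)
Lemma geom_exp (R : comNzRingType) (b n : nat) :
  (\sum_(k < b) 'X^k : {poly R}) ^+ n
  = \sum_(X : {ffun 'I_n -> 'I_b}) 'X^(\sum_k X k).
Proof.
rewrite -[in LHS](card_ord n) -prodr_const bigA_distr_bigA /=.
by apply: eq_bigr => X _; rewrite expr_sum.
Qed.

Lemma coef_geom_shift (R : comNzRingType) (b s m : nat) :
  ('X^s * (\sum_(k < b) 'X^k) : {poly R})`_m = (s <= m < s + b)%N%:R.
Proof.
rewrite coefXnM; case: ltnP => sm //=.
rewrite (eq_bigr (fun k : 'I_b => 1 *: 'X^k)) => [|k _]; last first.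
  by rewrite scale1r.
rewrite -(poly_def b (fun=> 1)) coef_poly.
by rewrite -ltn_subLR //; case: ifP.
Qed.

Lemma coef_geom_expS (R : comNzRingType) (b n m : nat) :
  ((\sum_(k < b) 'X^k : {poly R}) ^+ n.+1)`_m
  = #|[pred X : {ffun 'I_n -> 'I_b} |
        (\sum_k X k <= m < \sum_k X k + b)%N]|%:R.
Proof.
rewrite exprSr geom_exp mulr_suml coef_sum -sum1_card natr_sum.
rewrite [RHS]big_mkcond /=.
by apply: eq_bigr => X _; rewrite coef_geom_shift inE; case: ifP.
Qed.

Lemma sum_X_one (R : comNzRingType) (N : nat) :
  (1 - 'X) * (\sum_(k < N) 'X^k) = 1 - 'X^N :> {poly R}.
Proof. by rewrite -[LHS]opprK -mulNr opprB -subrX1 opprB. Qed.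

(* Truncation of (1 - X)^-(n+1) = \sum_k 'C(n + k, n) X^k. *)
Lemma negbin_trunc (R : comNzRingType) (n N : nat) :
  exists r : {poly R},
    (1 - 'X) ^+ n.+1 * (\sum_(k < N) 'C(n + k, n)%:R *: 'X^k) = 1 + 'X^N * r.
Proof.
elim: n => [|n [r IHn]].
  exists (-1); rewrite mulrN1 -sum_X_one; congr (_ * _).
  by apply: eq_bigr => k _; rewrite bin0 scale1r.
(* The correction is the boundary term below, times the remaining [(1 - 'X) ^+ n.+1]. *)
exists (r - (1 - 'X) ^+ n.+1 * 'C(n + N, n.+1)%:R%:P).
rewrite exprSr -mulrA.
(* Multiplying by [1 - 'X] takes differences of consecutive coefficients, which Pascal's rule
   evaluates; truncation leaves one term at ['X^N]. *)
have -> : (1 - 'X) * (\sum_(k < N) 'C(n.+1 + k, n.+1)%:R *: 'X^k)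
    = (\sum_(k < N) 'C(n + k, n)%:R *: 'X^k) - 'C(n + N, n.+1)%:R%:P * 'X^N
    :> {poly R}.
  elim: N {IHn r} => [|N IHN].
    by rewrite !big_ord0 addn0 bin_small // polyC0 mul0r mulr0 subr0.
  rewrite !big_ord_recr /= mulrDr IHN addnS !addSn binS natrD polyCD.
  rewrite -!mul_polyC polyCD exprS; ring.
rewrite mulrBr IHn; ring.
Qed.

Lemma coef_geom_exp_bin (R : comNzRingType) (b n m : nat) : (0 < b)%N ->
  ((\sum_(k < b) 'X^k : {poly R}) ^+ n.+1)`_m
  = \sum_(0 <= l < (m %/ b).+1)
      (-1) ^+ l * 'C(n.+1, l)%:R * 'C(n + m - l * b, n)%:R.
Proof.
move=> b0; set P := \sum_(k < b) _.
have [r Hr] := negbin_trunc R n m.+1; set S := \sum_(k < _) _ in Hr.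
(* [S] inverts [(1 - 'X) ^+ n.+1] modulo ['X^m.+1], and the error cannot reach degree [m]. *)
have -> : (P ^+ n.+1)`_m = ((1 - 'X^b) ^+ n.+1 * S)`_m.
  rewrite -sum_X_one exprMn mulrAC Hr mulrDl mul1r coefD -mulrA.
  by rewrite coefXnM ltnSn addr0.
have coefS l : ('X^(l * b) * S)`_m
    = if (l < (m %/ b).+1)%N then 'C(n + m - l * b, n)%:R else 0.
  rewrite ltnS leq_divRL // coefXnM ltnNge; case: leqP => //= lm.
  rewrite /S -(poly_def m.+1 (fun k => 'C(n + k, n)%:R)) coef_poly.
  by rewrite ltnS leq_subr addnBA.
pose F l : R := (-1) ^+ l * 'C(n.+1, l)%:R * ('X^(l * b) * S)`_m.
transitivity (\sum_(0 <= l < n.+2) F l).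
  rewrite exprBn mulr_suml coef_sum big_mkord; apply: eq_bigr => l _.
  rewrite expr1n mulr1 -exprM mulnC /F -[RHS]coefCM.
  apply: (congr1 (fun p : {poly R} => p`_m)).
  rewrite -mulr_natr polyCM polyC_exp polyCN polyC1 polyC_natr.
  ring.
(* [F l] vanishes for [l > n.+1] by its binomial and for [l > m %/ b] by its coefficient, so both
   ranges extend to [M]. *)
pose M := maxn n.+2 (m %/ b).+1.
transitivity (\sum_(0 <= l < M) F l).
  rewrite [RHS](big_cat_nat (n := n.+2)) ?leq_maxl //= [X in _ + X]big_nat.
  rewrite [X in _ + X]big1 ?addr0 // => l /andP[nl _].
  by rewrite /F bin_small // mulr0 mul0r.
rewrite (big_cat_nat (n := (m %/ b).+1)) ?leq_maxr //= [X in _ + X]big_nat.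
rewrite [X in _ + X]big1 ?addr0 => [|l /andP[ml _]]; last first.
  by rewrite /F coefS ltnNge ml mulr0.
by apply: eq_big_nat => l /andP[_ lm]; rewrite /F coefS lm.
Qed.

Lemma column_sumE (b n : nat) (X : column b n) :
  column_sum X = (\sum_k X k)%N%:Z - n%:Z * half_base b.
Proof.
rewrite /column_sum /digit big_split /= sumrN sumr_const card_ord.
by rewrite -mulr_natl natz (big_morph Posz PoszD (erefl _)).
Qed.

(** Shifting the [n] digits by [half_base b] adds [n * half_base b] to the column sum;
    [b = 2 * half_base b + 1] then makes the second bound strict. *)
Lemma is_carry_column (b n : nat) (i j : int) (X : column b n) : odd b ->
  is_carry b (i + column_sum X) j
  = ((\sum_k X k)%N%:Z <= j * b%:Z + n.+1%:Z * half_base b - i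
     < (\sum_k X k)%N%:Z + b%:Z).
Proof.
move=> ob; rewrite /is_carry column_sumE.
have eb : b%:Z = 2 * half_base b + 1 by rewrite /half_base; lia.
move: (half_base b) eb => h eb; set s := (\sum_k _)%N.
have -> : n.+1%:Z * h = n%:Z * h + h by rewrite -addn1 PoszD; ring.
lia.
Qed.

Lemma floor_ratio (m : int) (b : nat) : (0 < b)%N ->
  Num.floor (m%:~R / b%:R : rat) = (m %/ b%:Z)%Z.
Proof.
move=> b0; have bq : (0 : rat) < b%:R by rewrite ltr0n.
apply: floor_def; rewrite ler_pdivlMr // ltr_pdivrMr //.
rewrite !(pmulrn 1 b) -!intrM ler_int ltr_int.
have bz : (b : int) != 0 by lia.
by rewrite lez_floor // ltz_ceil.
Qed.

Lemma carries_K_coef (b n : nat) (i j : int) : odd b ->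
  carries_K b n i j
  = b%:R ^- n * coefz ((\sum_(k < b) 'X^k) ^+ n.+1 : {poly rat})
                  (j * b%:Z + n.+1%:Z * half_base b - i).
Proof.
move=> b_odd; rewrite /carries_K /unif_prob card_ffun !card_ord natrX mulrC.
congr (_ * _).
rewrite (eq_card (B := [pred X : column b n |
  (\sum_k X k)%N%:Z <= j * b%:Z + n.+1%:Z * half_base b - i
    < (\sum_k X k)%N%:Z + b%:Z])) => [|X]; last first.
  by rewrite !inE -is_carry_column.
(* For a negative exponent no column qualifies, since sums of shifted digits are nonnegative; this
   matches the default 0 of [coefz]. *)
case: (_ - i) => [m|m] /=; first by rewrite coef_geom_expS.
by rewrite eq_card0.
Qed.

Lemma coefz_geom_exp_bin (R : comNzRingType) (b n : nat) (m : int) :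
  (0 < b)%N ->
  coefz ((\sum_(k < b) 'X^k : {poly R}) ^+ n.+1) m
  = sum_upto (m %/ b%:Z)%Z (fun l : nat =>
      (-1) ^+ l * 'C(n.+1, l)%:R * (binz (n%:Z + m - l%:Z * b%:Z) n)%:R).
Proof.
move=> b_gt0; case: m => m /=; last first.
  (* A negative [m] has a negative quotient, so the sum is empty. *)
  have : (Negz m %/ b%:Z < 0)%Z by rewrite ltz_divLR ?mul0r.
  by case: divz.
rewrite coef_geom_exp_bin // divz_nat /=; apply: eq_big_nat => l /andP[_].
rewrite ltnS leq_divRL // => lm; congr (_ * _%:R).
(* Since [l * b <= m], the natural subtraction is exact and agrees with the argument of [binz]. *)
by rewrite -PoszD -PoszM subzn ?(leq_trans lm) ?leq_addl.
Qed.

Theorem theorem2p1 (b n : nat) (b_ge3 : (3 <= b)%N) (b_odd : odd b)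
    (n_gt0 : (0 < n)%N) (n_even : ~~ odd n) (i j : int)
    (i_state : - (n./2)%:Z <= i <= (n./2)%:Z)
    (j_state : - (n./2)%:Z <= j <= (n./2)%:Z) :
  carries_K b n i j =
    coefz ((b%:R ^- n) *: (\sum_(k < b) 'X^k) ^+ n.+1 : {poly rat})
      (j * b%:Z + n.+1%:Z * half_base b - i)
  /\
  carries_K b n i j =
    b%:R ^- n *
    sum_upto
      (Num.floor (j%:~R + n.+1%:R / b%:R * ((b%:R - 1) / 2) - i%:~R / b%:R : rat))
      (fun l : nat =>
         (-1) ^+ l * 'C(n.+1, l)%:R *
         (binz (n%:Z + j * b%:Z + n.+1%:Z * half_base b - i - l%:Z * b%:Z)
            n)%:R).
Proof.
have b_gt0 : (0 < b)%N by apply: leq_trans b_ge3.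
(* As [b] is odd, [half_base b] is exactly [(b - 1) / 2], so the upper limit is the floor of the
   exponent over [b]. *)
have -> : j%:~R + n.+1%:R / b%:R * ((b%:R - 1) / 2) - i%:~R / b%:R
    = (j * b%:Z + n.+1%:Z * half_base b - i)%:~R / b%:R :> rat.
  have eb : (b%:R : rat) = 2 * (half_base b)%:~R + 1.
    rewrite (pmulrn 1 b).
    have -> : b%:Z = 2 * half_base b + 1 by rewrite /half_base; lia.
    by rewrite intrD intrM.
  have bq : (b%:R : rat) != 0 by rewrite pnatr_eq0 -lt0n.
  rewrite !(intrD, intrM, intrN, =^~ pmulrn).
  have -> : (b%:R - 1) / 2 = (half_base b)%:~R :> rat by rewrite eb; field.
  by field.
rewrite floor_ratio // carries_K_coef //; split.
  by case: (_ - i) => m /=; rewrite ?coefZ ?mulr0.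
by rewrite coefz_geom_exp_bin // !addrA.
Qed.
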